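(* Let $C_n=\frac{1}{2n+1}\binom{2n+1}{n}$ be the $n$-th Catalan number. For $n\ge1$, in the polynomial ring $K[x_1,\ldots,x_{2n}]$, the number of minimal generators of the ideal $$I_{2n,n+1}=\bigcap_{\substack{F\subset[2n]\\ \#F=n+1}}(x_i-x_j\mid i,j\in F)$$ is $C_n$. Similarly, for $n\ge 2$, the ideal $$I_{2n-1,n+1}=\bigcap_{\substack{F\subset[2n-1]\\ \#F=n+1}}(x_i-x_j\mid i,j\in F)\subset K[x_1,\ldots,x_{2n-1}]$$ is also generated by $C_n$ elements.
   Context: $K$ is a field and $[m]=\{1,\ldots,m\}$. The ideals involved are homogeneous for the standard grading, and the number of minimal generators means the minimal number of (homogeneous) generators. *)

(* Defs.v *)
From HB Require Import structures.
From mathcomp Require Import all_boot all_order all_algebra.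
From mathcomp Require Export mpoly.

Set Implicit Arguments.
Unset Strict Implicit.
Unset Printing Implicit Defensive.

Import GRing.Theory.

(* The quotient is exact, by catalanE below. *)
Definition catalan (n : nat) : nat := 'C((2 * n).+1, n) %/ (2 * n).+1.

Lemma catalanE n : catalan n * (2 * n).+1 = 'C((2 * n).+1, n).
Proof.
apply: divnK; case: n => [|n]; first by rewrite dvd1n.
rewrite -(@Gauss_dvdr _ n.+1).
  by rewrite -mul_bin_diag dvdn_mulr.
by rewrite -addn1 /coprime gcdnC gcdnMDl gcdn1.
Qed.

Local Open Scope ring_scope.

(* Ideals are Prop-valued predicates: the ideals of ring_quotient are decidable
   and proper, which is not wanted here. *)
Definition ideal_gen (R : comNzRingType) (S : R -> Prop) : R -> Prop :=
  fun p => exists2 s : seq (R * R),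
    (forall c, c \in s -> S c.2) & p = \sum_(c <- s) c.1 * c.2.

Definition generates (R : comNzRingType) (s : seq R) (I : R -> Prop) : Prop :=
  forall p, I p <-> ideal_gen (fun q => q \in s) p.

Definition homogeneous (K : fieldType) (m : nat) (p : {mpoly K[m]}) : Prop :=
  exists d : nat, p \is d.-homog.

(* The minimum is taken over all finite generating families and is required to
   be attained by a homogeneous one, so that c is the minimal number of
   generators and also the minimal number of homogeneous generators. *)
Definition min_num_generators (K : fieldType) (m : nat)
    (I : {mpoly K[m]} -> Prop) (c : nat) : Prop :=
  (exists s : seq {mpoly K[m]},
     [/\ size s = c, forall p, p \in s -> homogeneous p & generates s I]) /\
  (forall s : seq {mpoly K[m]}, generates s I -> (c <= size s)%N).

Definition diff_ideal (K : fieldType) (m : nat) (F : {set 'I_m}) :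
    {mpoly K[m]} -> Prop :=
  ideal_gen (fun q => exists i j : 'I_m,
    [/\ i \in F, j \in F & q = 'X_i - 'X_j]).

Definition subset_ideal (K : fieldType) (m k : nat) : {mpoly K[m]} -> Prop :=
  fun p => forall F : {set 'I_m}, #|F| = k -> diff_ideal F p.
Arguments subset_ideal : clear implicits.

(* Main.v *)
Require Import Defs.
From mathcomp Require Import all_boot all_order all_algebra.
From mathcomp Require Import zify ring.

Set Implicit Arguments.
Unset Strict Implicit.
Unset Printing Implicit Defensive.

Import Order.TTheory GRing.Theory.
Import Order.DefaultSeqLexiOrder.

(** Write m = N + d with d <= N, and let I be the ideal of the polynomials in
m variables that vanish wherever N + 1 of the variables coincide; the theorem
is the case N = n with d = n or d = n - 1. For a labelling b of the variables
by N labels, let [vander b] be the product of the differences x_i - x_j over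
the pairs i < j with b i = b j, that is, the product of the Vandermonde
determinants of the blocks of b. It lies in I, because two of any N + 1
variables share a label. The proof has four ingredients.

Leading monomials. Read an exponent sequence a from its last entry to its first
and let each entry e add a box to a Young diagram, in the first row that is as
long as row e; [rows] are the row lengths, and [columns] the columns that
receive the boxes. If a is the leading exponent of a nonzero homogeneous
element of I, then row 0 has length at most N ([rows_mlead]). So labelling
every variable by its column uses at most N labels, and the leading exponent of
the resulting [vander] is at most a ([mlead_greedy_le]), because it counts, for
each variable, the later variables of the same column. Dividing repeatedly
shows that the products [vander b] generate I ([vanishing_reduction]).
The bound on row 0 comes from a stronger statement, [terms_eval_neq0]: a
polynomial with leading exponent a cannot vanish at all the points whose
coincidence pattern dominates the diagram of a. This goes by induction on the
number of variables. If the remaining variables take values that dominate the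
diagram before the entry e of the first variable is placed, then at least e + 1
values of the first variable give a point that dominates the final diagram
([dominates_cons]); a polynomial of degree e in that variable with e + 1 roots
is zero, hence so is the coefficient of the e-th power, against the induction
hypothesis. Points are taken in K[t], since K may be finite.

Balancing. When a block of b has at least two elements more than another one,
Lagrange interpolation writes [vander b] as a combination of the products
obtained by moving one element from the larger block to the smaller one
([vander_exchange]). The process ends at blocks of sizes 1 and 2, where
[vander b] has degree d ([card_inner_pair_balanced]), so I is generated by
elements of degree d.

The part of degree d. A box outside row 0 comes from a nonzero exponent, so the
length of row 0 plus the degree is at least m ([size_le_rows]). Hence no
element of I has a term of degree less than d, and in degree d the leading
exponents are the 0/1 sequences for which equality holds: the ballot words with
d ones and N zeros. Each of them is the leading exponent of the product that it
labels ([mlead_greedy_ballot]). These products are therefore a basis of the part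
of degree d, and they generate I. Conversely, since I starts in degree d, the
components of degree d of any generating family span that part, so no family
can be smaller ([size_generators]).

Counting. The ballot words are counted by a difference of two binomial
coefficients ([size_words]), which is the Catalan number for both values of d. *)

(** * Greedy diagrams of exponent sequences *)

(** The row that receives the box of an entry e. The bound e + 1 of the search
range is enough, as row e itself qualifies; every box in row j thus comes from
an entry at least j. *)
Definition first_row (r : nat -> nat) (e : nat) : nat :=
  find (fun j => r j == r e) (iota 0 e.+1).

Fixpoint rows (a : seq nat) : nat -> nat :=
  if a is e :: a' then
    fun i => rows a' i + (i == first_row (rows a') e)
  else fun=> 0.

(** The box of e is put at the end of a row of the same length as row e, hence in
the column numbered by that length. *)
Fixpoint columns (a : seq nat) : seq nat :=
  if a is e :: a' then rows a' e :: columns a' else [::].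

Lemma first_rowP r e : [/\ first_row r e <= e, r (first_row r e) = r e
  & forall j, j < first_row r e -> r j != r e].
Proof.
rewrite /first_row; set p := fun j => _.
have hp : has p (iota 0 e.+1).
  by apply/hasP; exists e; rewrite ?mem_iota ?add0n ?leqnn //= /p.
have lt_f : find p (iota 0 e.+1) < e.+1 by rewrite -[X in _ < X](size_iota 0) -has_find.
split.
- by rewrite -ltnS.
- by have := nth_find 0 hp; rewrite nth_iota // add0n => /eqP.
- move=> j lt_j; have := before_find 0 lt_j.
  by rewrite nth_iota ?(ltn_trans lt_j) // add0n /p => ->.
Qed.

Lemma size_columns a : size (columns a) = size a.
Proof. by elim: a => //= e a ->. Qed.

(** [columns] and [rows] describe one diagram, whose columns are filled from row 0
downwards: column c has more than i boxes exactly when row i is longer than c.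
This holds because the new box goes to the first of the rows of its length, so
that the rows above it are strictly longer. *)
Lemma count_columns a c i : (i < count_mem c (columns a)) = (c < rows a i).
Proof.
elim: a c i => [|e a IH] c i; first by rewrite ltn0.
rewrite [rows _ _]/= [columns _]/= [count_mem _ _]/=.
set r := rows a; have [] := first_rowP r e; set j := first_row r e => le_je rj min_j.
have mono k l : k <= l -> r l <= r k.
  move=> le_kl; rewrite leqNgt -IH; apply/negP => h.
  have := IH (r k) k; rewrite -/r ltnn => /negbT; rewrite -leqNgt => h'.
  by move: (leq_trans (leq_ltn_trans le_kl h) h'); rewrite ltnn.
have IHc := IH c; case: (eqVneq (r e) c) => [<-|ne_c].
  have IHe := IH (r e); have h0 := IHe j; rewrite -/r rj ltnn in h0.
  have hc : forall l, l < j -> l < count_mem (r e) (columns a).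
    by move=> l lt_l; rewrite IHe -/r; have := min_j _ lt_l; have := mono l e; lia.
  (* the column of the new box has so far one box in each row above it *)
  have cj : count_mem (r e) (columns a) = j.
    apply/eqP; rewrite eqn_leq leqNgt h0 /=.
    by case: (posnP j) => [->//|j0]; rewrite -(prednK j0) hc ?prednK.
  rewrite cj; case: (ltngtP i j) => [lt_ij|lt_ji|->].
  - by have := hc _ lt_ij; rewrite IHe -/r; lia.
  - by have := mono j i; lia.
  - by lia.
rewrite add0n IHc -/r; case: (eqVneq i j) => [->|_]; last by rewrite addn0.
by rewrite rj; lia.
Qed.

Lemma rows_le a i j : i <= j -> rows a j <= rows a i.
Proof.
move=> le_ij; rewrite leqNgt -count_columns; apply/negP => h.
have : j < count_mem (rows a i) (columns a) by rewrite count_columns; move: h; rewrite count_columns.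
by have := count_columns a (rows a i) i; rewrite ltnn; lia.
Qed.

Lemma columns_lt a c : c \in columns a -> c < rows a 0.
Proof. by rewrite -count_columns -has_count has_pred1. Qed.

(** The entry that selects a column bounds the number of boxes already there; this
is what makes the leading exponents of the associated product small. *)
Lemma count_columns_le e a : count_mem (rows a e) (columns a) <= e.
Proof. by rewrite leqNgt count_columns ltnn. Qed.

Lemma drop_columns k a : drop k (columns a) = columns (drop k a).
Proof. by elim: a k => [|e a IH] [|k] //=. Qed.

Lemma nth_columns k a : (k < size a)%N ->
  nth 0%N (columns a) k = rows (drop k.+1 a) (nth 0%N a k).
Proof. by elim: a k => [|e a IH] [|k] //=; [rewrite drop0|apply: IH]. Qed.

(** * Ballot words *)

(** A box outside row 0 comes from an entry at least 1. *)
Lemma size_le_rows a : size a <= rows a 0 + sumn a.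
Proof.
elim: a => //= e a IH; have [le_j _ _] := first_rowP (rows a) e.
by case: (first_row _ _) le_j => [|j] /= le_j; lia.
Qed.

(** The equality case of [size_le_rows]. By [ballot_cons] the entries are then 0 or
1, the zeros fill row 0 and the ones fill row 1, so that every suffix has at
least as many zeros as ones. *)
Definition ballot a := rows a 0 + sumn a == size a.

Lemma ballot_cons e a : ballot (e :: a) =
  ballot a && ((e == 0) || (e == 1) && (rows a 1 < rows a 0)).
Proof.
rewrite /ballot [rows _ _]/= [sumn _]/= [size (_ :: _)]/=.
have := size_le_rows a; have [le_j rj min_j] := first_rowP (rows a) e.
have le10 := rows_le a (isT : 0 <= 1).
have e1 : e = 1 -> (rows a 1 < rows a 0) = (first_row (rows a) e != 0).
  move=> e1; move: rj le_j min_j; rewrite e1.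
  case: (first_row _ _) => [|[|//]] /=; first by move=> ->; rewrite ltnn.
  by move=> _ _ /(_ 0 isT); lia.
move: le_j rj; case: (eqVneq e 0) => [->|e0].
  by rewrite leqn0 => /eqP-> _ /=; rewrite andbT; lia.
case: (eqVneq e 1) => [E|ne1]; first by rewrite (e1 E) E; case: (first_row _ _) => [|j] /=; lia.
by case: (first_row _ _) => [|j] /=; lia.
Qed.

Lemma ballot_drop k a : ballot a -> ballot (drop k a).
Proof.
by elim: a k => [|e a IH] [|k] //=; rewrite ballot_cons => /andP[/IH].
Qed.

Lemma ballot_rows1 a : ballot a -> rows a 1 = sumn a.
Proof.
elim: a => //= e a IH; rewrite ballot_cons => /andP[/IH IHa].
have [le_j rj min_j] := first_rowP (rows a) e.
case/orP => [/eqP e0|/andP[/eqP e1 lt]].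
  by move: le_j; rewrite e0 leqn0 => /eqP->; rewrite IHa /= addn0.
suff -> : first_row (rows a) e = 1 by rewrite IHa e1 addnC.
move: rj le_j; rewrite e1; case: (first_row _ _) => [|[]] //.
by move=> h; rewrite h ltnn in lt.
Qed.

(** Sequences of length m with d ones. The test [2 * d <= m], repeated at each
suffix, is the ballot condition. *)
Fixpoint words m d : seq (seq nat) :=
  match m with
  | 0 => if d is 0 then [:: [::]] else [::]
  | m'.+1 => if 2 * d <= m then
      [seq 0 :: a | a <- words m' d] ++
      (if d is d'.+1 then [seq 1 :: a | a <- words m' d'] else [::])
    else [::]
  end.

Lemma mem_words m d a :
  (a \in words m d) = [&& size a == m, sumn a == d & ballot a].
Proof.
have half a' : ballot a' -> 2 * sumn a' <= size a'.
  by move=> ba; have := rows_le a' (isT : 0 <= 1); rewrite ballot_rows1 //; move/eqP: ba; lia.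
elim: m d a => [|m IH] d a.
  case: d => [|d]; case: a => [|e a] //=.
rewrite /=; case: ifP => [le_d|]; last first.
  move=> gt_d; apply/esym/negP => /and3P[/eqP sa /eqP da /half].
  by rewrite sa da gt_d.
rewrite mem_cat; apply/orP/and3P.
  case=> [/mapP[a']|]; last case: d le_d => [|d] le_d // /mapP[a'].
    by rewrite IH => /and3P[/eqP <- /eqP<- ba] -> /=; rewrite ballot_cons ba !eqxx.
  rewrite IH => /and3P[/eqP sa /eqP da ba] ->; rewrite /= sa da ballot_cons ba !eqxx /=.
  by split=> //; rewrite ballot_rows1 //; move/eqP: ba; rewrite sa da; lia.
case: a => [|e a] [] //= /eqP[sa] /eqP da; rewrite ballot_cons => /andP[ba].
case/orP => [/eqP e0|/andP[/eqP e1 _]]; [left|right].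
  by apply/mapP; exists a; rewrite ?e0 // IH sa eqxx ba andbT; apply/eqP; lia.
case: d da le_d => [|d] da le_d; first by lia.
by apply/mapP; exists a; rewrite ?e1 // IH sa eqxx ba andbT; apply/eqP; lia.
Qed.

Lemma uniq_words m d : uniq (words m d).
Proof.
elim: m d => [|m IH] d; first by case: d.
rewrite /=; case: ifP => // _; rewrite cat_uniq map_inj_uniq ?IH => [|x y []] //=.
case: d => [|d] //; rewrite map_inj_uniq ?IH => [|x y []] //; rewrite andbT.
by apply/hasPn => x /mapP[y _ ->]; apply/negP => /mapP[].
Qed.

(** Both sides satisfy the recursion of Pascal's triangle. On the boundary
[2 * d = m.+1] there are no words, and the two binomial coefficients agree by
symmetry. *)
Lemma size_words m d : 2 * d <= m.+1 ->
  size (words m d) + (if d is d'.+1 then 'C(m, d') else 0) = 'C(m, d).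
Proof.
elim: m d => [|m IH] d le_d; first by case: d le_d => [|[|]].
rewrite [words _ _]/=; case: leqP => [le_dm|gt_dm]; last first.
  case: d le_d gt_dm => [|d] le_d gt_dm; first by lia.
  rewrite /= add0n -bin_sub; last by lia.
  by congr 'C(_, _); lia.
rewrite size_cat size_map; case: d le_d le_dm => [|d] le_d le_dm.
  by have := IH 0 isT; rewrite !bin0 /=; lia.
rewrite size_map binS; have := IH d.+1 le_dm; have := IH d ltac:(lia).
case: d {le_d le_dm} => [|d] /=; rewrite ?bin0 ?binS; lia.
Qed.

Lemma size_words_catalan n : size (words (2 * n) n) = catalan n.
Proof.
have := size_words (leqnSn (2 * n)); case: n => [//|n] hs.
set m := 2 * n.+1 in hs *.
have e1 : m.+1 * 'C(m, n.+1) = n.+2 * 'C(m.+1, n.+1).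
  rewrite mul_bin_diag -(@bin_sub m.+1); last by rewrite /m; lia.
  by congr (_ * 'C(_, _)); rewrite /m; lia.
have e2 := mul_bin_diag m.+1 n; have e3 := catalanE n.+1.
rewrite -/m in e3; apply/eqP; rewrite -(eqn_pmul2r (ltn0Sn m)) e3; apply/eqP.
by apply: (@addIn (m.+1 * 'C(m, n))); rewrite {2}e2 -mulSn -e1 -hs mulnDr mulnC.
Qed.

Lemma size_words_catalan_pred n : 0 < n -> size (words (2 * n - 1) n.-1) = catalan n.
Proof.
case: n => // n _; rewrite -size_words_catalan.
have -> : 2 * n.+1 - 1 = (2 * n).+1 by lia.
have -> : 2 * n.+1 = (2 * n).+2 by lia.
rewrite [in RHS]/= ifT; last by lia.
rewrite size_cat !size_map /=.
have -> : (2 * n.+1 <= (2 * n).+1) = false by lia.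
by rewrite add0n.
Qed.

(** * Points whose coincidences dominate a diagram *)

Section Dom.
Variable A : eqType.

(** The multiset of multiplicities of the values in v dominates the partition r:
for each c, some c values account for at least the first c rows. Choosing the
values existentially avoids sorting multiplicities. *)
Definition dominates (v : seq A) (r : nat -> nat) : Prop :=
  forall c, exists2 S : seq A, size S <= c &
    \sum_(0 <= i < c) r i <= count (mem S) v.

Lemma count_mem_sumn (S v : seq A) : uniq S ->
  count (mem S) v = sumn [seq count_mem x v | x <- S].
Proof.
elim: S => [|x S IH] /=; first by move=> _; apply: count_pred0.
case/andP=> xS uS; rewrite -IH //.
have -> : count (mem (x :: S)) v = count (predU (pred1 x) (mem S)) v.
  by apply: eq_count => y; rewrite /= inE.
rewrite -[RHS]count_predUI; set n := count (predI _ _) v.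
suff -> : n = 0 by rewrite addn0.
apply/eqP; rewrite -leqn0 leqNgt -has_count; apply/hasP => -[y _] /= /andP[/eqP-> ].
by rewrite (negPf xS).
Qed.

(** The first c terms of a decreasing sequence have the largest sum among all
choices of c terms. *)
Lemma sumn_filter_le (f : A -> nat) (p : pred A) (L : seq A) (c : nat) :
  sorted (fun x y => f y <= f x) L -> count p L <= c ->
  sumn [seq f x | x <- L & p x] <= sumn [seq f x | x <- take c L].
Proof.
elim: L c => [|x L IH] c //= sL.
have tr : transitive (fun x y => f y <= f x).
  by move=> a b d h1 h2; apply: leq_trans h2 h1.
have sL' := path_sorted sL.
case: (p x) => /=; first by case: c => [|c] //= le_c; rewrite leq_add2l IH.
case: c => [|c] /=; first by have := IH 0 sL'; rewrite take0 add0n.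
rewrite add0n => le_c; apply: leq_trans (IH c.+1 sL' le_c) _.
have {}sL := order_path_min tr sL.
case: (ltnP c (size L)) => [lt_c|le_cL]; last first.
  by rewrite !take_oversize ?leq_addl //; apply: leq_trans le_cL _.
rewrite (take_nth x lt_c) map_rcons sumn_rcons addnC leq_add2r.
by move/allP: sL; apply; apply: mem_nth.
Qed.

Lemma fresh_seq (hinf : forall s : seq A, exists x, x \notin s) (s : seq A) n :
  exists L, [/\ uniq L, size L = n & forall x, x \in L -> x \notin s].
Proof.
elim: n => [|n [L [uL sL dL]]]; first by exists [::].
have [x] := hinf (s ++ L); rewrite mem_cat negb_or => /andP[xs xL].
exists (x :: L); split; rewrite /= ?xL ?sL // => y; rewrite inE => /orP[/eqP->|/dL] //.
Qed.

(** Sort the values by decreasing multiplicity nu 0, nu 1, and so on, adding fresh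
values of multiplicity 0 if there are fewer than e + 1. The first e + 1 of them
work. To dominate the first c rows after the new value t = t_i is prepended, the c
most frequent values suffice if t is one of them, if they already count more than
the old rows require, or if the new box lies in a later row. In the remaining
case j < c <= i, where j is the row of the new box, rows j to e have equal
length; domination at the neighbouring indices then forces nu (c - 1) <= nu i,
so t may replace the last of the c values. *)
Lemma dominates_cons (hinf : forall s : seq A, exists x, x \notin s)
    (v : seq A) (r : nat -> nat) (e : nat) :
  (forall i j, i <= j -> r j <= r i) -> dominates v r ->
  exists us : seq A, [/\ uniq us, size us = e.+1 & forall t, t \in us ->
    dominates (t :: v) (fun i => r i + (i == first_row r e))].
Proof.
move=> mono Dv.
have [W [uW sW dW]] := fresh_seq hinf v e.+1.
pose f x := count_mem x v; pose ge x y := f y <= f x.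
pose L := sort ge (undup v ++ W).
have uL : uniq L.
  rewrite sort_uniq cat_uniq undup_uniq uW andbT /=.
  by apply/hasPn => x /dW; rewrite mem_undup.
have sL : sorted ge L by apply: sort_sorted => x y; apply: leq_total.
have vL : {subset v <= L} by move=> x xv; rewrite mem_sort mem_cat mem_undup xv.
have szL : e < size L by rewrite size_sort size_cat sW; lia.
have [t0 _] := hinf [::].
pose nu i := f (nth t0 L i); pose N c := count (mem (take c L)) v.
have tr : transitive ge by move=> a b d h1 h2; apply: leq_trans h2 h1.
have nu_le i j : i <= j -> j < size L -> nu j <= nu i.
  move=> le_ij lt_j.
  by apply: (sorted_leq_nth tr _ t0 sL) => //; rewrite ?inE ?(leq_ltn_trans le_ij) // => x; apply: leqnn.
have NE c : N c = sumn [seq f x | x <- take c L] by rewrite /N count_mem_sumn ?take_uniq.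
have NS c : c < size L -> N c.+1 = N c + nu c.
  by move=> lt_c; rewrite !NE (take_nth t0 lt_c) map_rcons sumn_rcons.
pose R c := \sum_(0 <= i < c) r i.
have RS c : R c.+1 = R c + r c by rewrite /R big_nat_recr.
(* N c is the largest count that c values can have, by sortedness *)
have NR c : R c <= N c.
  have [S sS hS] := Dv c; apply: leq_trans hS _.
  have eS : count (mem S) v = count (mem [seq x <- L | x \in S]) v.
    by apply: eq_in_count => x xv; rewrite /= mem_filter (vL _ xv) andbT.
  rewrite eS count_mem_sumn ?filter_uniq // NE; apply: sumn_filter_le => //.
  rewrite -size_filter; apply: leq_trans sS; apply: uniq_leq_size.
    by rewrite filter_uniq.
  by move=> x; rewrite mem_filter => /andP[].
have [] := first_rowP r e; set j := first_row r e => le_je rj min_j.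
have R'E c : \sum_(0 <= i < c) (r i + (i == j)) = R c + (j < c).
  elim: c => [|c IH]; first by rewrite /R !big_geq.
  by rewrite big_nat_recr //= IH RS; lia.
exists (take e.+1 L); split; rewrite ?take_uniq ?size_takel //.
move=> t /(nthP t0)[i]; rewrite size_takel // => lt_i; rewrite nth_take // => <- c.
have lt_iL : i < size L by lia.
set t' := nth _ _ _.
have [lt_ic|le_ci] := ltnP i c.
  exists (take c L); first by rewrite size_take_min geq_minl.
  rewrite R'E /=; have -> : t' \in take c L.
    by rewrite /t' -(nth_take t0 lt_ic) mem_nth // size_take_min leq_min lt_ic lt_iL.
  by rewrite addnC leq_add ?leq_b1 //; apply: NR.
have [tight|] := leqP (N c) (R c); last first.
  move=> lt_N; exists (take c L); first by rewrite size_takel //; lia.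
  by rewrite R'E /=; move: lt_N; rewrite /N; lia.
have [lt_jc|le_cj] := ltnP j c; last first.
  exists (take c L); first by rewrite size_takel //; lia.
  by rewrite R'E ltnNge le_cj addn0 /= (leq_trans (NR c)) ?leq_addl.
(* what follows is the tight case, with c replaced by its successor; rows j to e
   have the same length by the choice of j *)
have rE k : j <= k -> k <= e -> r k = r e.
  by move=> h1 h2; have := mono _ _ h1; have := mono _ _ h2; lia.
case: c => // c in le_ci tight lt_jc *.
have nuc : nu c <= r e.
  have := NR c; move: tight; rewrite NS ?RS; last lia.
  by rewrite (rE c) //; lia.
have hN k : c.+1 + k <= i -> N (c.+1 + k) <= R c.+1 + k * r e.
  elim: k => [|k IH] le_k; first by rewrite addn0 mul0n addn0.
  rewrite addnS NS; last lia.
  have := IH ltac:(lia); have := nu_le c (c.+1 + k) ltac:(lia) ltac:(lia).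
  by rewrite mulSn; lia.
have hR k : c.+1 + k <= e.+1 -> R (c.+1 + k) = R c.+1 + k * r e.
  elim: k => [|k IH] le_k; first by rewrite addn0 mul0n addn0.
  by rewrite addnS RS IH ?(rE (c.+1 + k)) ?mulSn; lia.
have nui : nu c <= nu i.
  have := NR i.+1; rewrite NS //.
  have -> : i.+1 = c.+1 + (i - c) by lia.
  rewrite hR; last lia.
  have := hN (i - c.+1) ltac:(lia).
  have -> : c.+1 + (i - c.+1) = i by lia.
  have -> : i - c = (i - c.+1).+1 by lia.
  by rewrite mulSn; lia.
exists (t' :: take c L); first by rewrite /= size_takel //; lia.
rewrite R'E lt_jc /= inE eqxx.
have ut : t' \notin take c L.
  apply/negP => /(nthP t0)[k]; rewrite size_takel; last lia.
  by move=> lt_k; rewrite nth_take // => /eqP; rewrite nth_uniq //; lia.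
rewrite count_mem_sumn /=; last by rewrite ut take_uniq //.
rewrite -NE -/(f t') -/(nu i).
by have := NR c.+1; rewrite NS; lia.
Qed.

End Dom.

(** * Leading monomials of vanishing polynomials *)

Section Vanish.
Local Open Scope ring_scope.
Variable A : idomainType.

(** Polynomials are handled here as lists of exponent sequences with coefficients,
the first variable being the most significant: this makes induction on the
number of variables a recursion on lists. *)
Fixpoint monom (b : seq nat) (v : seq A) : A :=
  match b, v with
  | e :: b', t :: v' => t ^+ e * monom b' v'
  | _, _ => 1
  end.

Definition terms_eval (S : seq (seq nat)) (c : seq nat -> A) (v : seq A) : A :=
  \sum_(b <- S) c b * monom b v.

Lemma monomE (b : seq nat) (v : seq A) : size b = size v ->
  monom b v = \prod_(i < size v) v`_i ^+ nth 0%N b i.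
Proof.
elim: b v => [|e b IH] [|t v] //=; first by rewrite big_ord0.
by case=> sb; rewrite big_ord_recl /= IH.
Qed.

(** At a point v of the remaining variables that dominates the diagram of
the tail of a, the polynomial in the first variable has degree at most e and
e + 1 roots by [dominates_cons], so its coefficient of degree e vanishes. That
coefficient is the polynomial S', c' whose leading exponent is the tail of a. *)
Lemma terms_eval_neq0 (hinf : forall s : seq A, exists x, x \notin s)
    (a : seq nat) (S : seq (seq nat)) (c : seq nat -> A) :
  uniq S -> (forall b, b \in S -> size b = size a /\ (b <= a)%O) ->
  a \in S -> c a != 0 ->
  ~ (forall v, size v = size a -> dominates v (rows a) ->
       terms_eval S c v = 0).
Proof.
elim: a S c => [|e a IH] S c uS maxa aS ca van.
  have S1 : S = [:: [::]].
    have sub : {subset S <= [:: [::]]}.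
      by move=> b /maxa [/size0nil-> _]; rewrite mem_head.
    have := uniq_leq_size uS sub; case: S aS uS sub {maxa van} => [|x [|y S]] //.
    by rewrite inE => /eqP<-.
  have := van [::] erefl; rewrite /terms_eval S1 big_seq1 /= mulr1 => c0.
  by rewrite c0 ?eqxx // in ca => k; exists [::]; rewrite //= big1_eq.
pose S' := [seq behead b | b <- S & head 0%N b == e].
have cons_inS b : b \in S' -> e :: b \in S.
  case/mapP => b0; rewrite mem_filter => /andP[/eqP h0 b0S] ->.
  by have [] := maxa _ b0S; case: b0 h0 b0S => //= x b0 -> .
apply: (IH S' (fun b => c (e :: b))) => //.
- rewrite map_inj_in_uniq ?filter_uniq // => x y.
  rewrite !mem_filter => /andP[/eqP hx xS] /andP[/eqP hy yS].
  have [+ _] := maxa _ xS; have [+ _] := maxa _ yS.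
  by case: x hx {xS} => //= ? x ->; case: y hy {yS} => //= ? y -> _ _ ->.
- move=> b /cons_inS/maxa[/= [->]]; split=> //.
  by move: b0; rewrite lexi_cons lexx.
- by apply/mapP; exists (e :: a); rewrite ?mem_filter //= eqxx.
move=> v sv Dv.
have [us [uus sus hus]] := dominates_cons hinf e (@rows_le a) Dv.
pose q : {poly A} :=
  \sum_(b <- S) (c b * monom (behead b) v) *: 'X^(head 0%N b).
have szq : (size q <= e.+1)%N.
  apply: (leq_trans (size_sum _ _ _)); rewrite big_seq; apply/bigmax_leqP_seq => b _ bS.
  apply: leq_trans (size_scale_leq _ _) _; rewrite size_polyXn ltnS.
  have [+ +] := maxa _ bS; case: b {bS} => //= x b _.
  by rewrite lexi_cons => /andP[].
have rootq t : t \in us -> root q t.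
  move=> tus; rewrite /root horner_sum.
  have := van (t :: v) _ (hus _ tus); rewrite /= sv => /(_ erefl) van_t.
  apply/eqP; rewrite -[RHS]van_t /terms_eval !big_seq; apply: eq_bigr => b bS.
  rewrite hornerZ hornerXn; have [+ _] := maxa _ bS; case: b {bS} => //= x b _.
  by rewrite -mulrA [X in _ * X]mulrC.
have q0 : q = 0.
  apply/eqP/negPn/negP => nzq.
  have := max_poly_roots nzq _ uus; rewrite sus => h.
  by have := leq_trans (h (introT allP rootq)) szq; rewrite ltnn.
have : q`_e = 0 by rewrite q0 coef0.
move=> <-; rewrite /terms_eval big_map big_filter coef_sum.
rewrite big_mkcond [LHS]big_seq [RHS]big_seq; apply: eq_bigr => b bS.
rewrite coefZ coefXn eq_sym; case: eqP => [h|_]; last by rewrite mulr0.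
rewrite mulr1; have [+ _] := maxa _ bS.
by case: b h {bS} => //= x b ->.
Qed.
End Vanish.

Section InfiniteRing.
Local Open Scope ring_scope.

Lemma poly_infinite (K : fieldType) (s : seq {poly K}) : exists x, x \notin s.
Proof.
exists 'X^(\sum_(p <- s) size p)%N; apply/negP => xs.
have : (size ('X^(\sum_(p <- s) size p) : {poly K}) <= \sum_(p <- s) size p)%N.
  by rewrite [X in (_ <= X)%N](big_rem _ xs) leq_addr.
by rewrite size_polyXn ltnn.
Qed.

End InfiniteRing.

Section Null.
Local Open Scope ring_scope.
Variables (K : fieldType) (m : nat).
Implicit Types (f g : {mpoly K[m]}) (v : 'I_m -> {poly K}).

Definition peval v f : {poly K} := mmap (@polyC K) v f.

(** Membership in [subset_ideal] is used only through this consequence, which is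
stable under taking homogeneous components ([vanishing_pihomog]). *)
Definition vanishing k f : Prop :=
  forall v t, (k <= #|[set i | v i == t]|)%N -> peval v f = 0.

Lemma card_coord (T : eqType) (x0 : T) (v : seq T) (t : T) : size v = m ->
  #|[set i : 'I_m | nth x0 v i == t]| = count_mem t v.
Proof.
move=> sv; rewrite cardsE -sum1_card -sum1_count (big_nth x0) sv big_mkord.
by apply: eq_bigl => i; rewrite inE.
Qed.

(** Otherwise every point that dominates the diagram has k equal coordinates, as one
sees from the first row alone, so f would vanish at all of them. *)
Lemma rows_mlead k d f : f \is d.-homog -> f != 0 -> vanishing k f ->
  (rows (mlead f) 0 < k)%N.
Proof.
move=> hf nzf van; rewrite ltnNge; apply/negP => le_k.
pose mn (b : seq nat) : 'X_{1..m} := [multinom nth 0%N b i | i < m].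
have mnK (b : 'X_{1..m}) : mn b = b by apply/mnmP => i; rewrite mnmE -mnm_nth.
apply: (@terms_eval_neq0 _ (@poly_infinite K) (mlead f) [seq val (val b) | b <- msupp f]
  (fun b => (f@_(mn b))%:P)).
- rewrite map_inj_uniq ?msupp_uniq // => x y /= h.
  by rewrite -[x]mnK -[y]mnK /=; congr mn.
- move=> b /mapP[b0 b0f ->]; rewrite !size_tuple; split=> //.
  have := msupp_le_mlead b0f; rewrite leEmnm.
  have := dhomog_mf hf => hmf.
  by rewrite (hmf _ b0f) (hmf _ (mlead_supp nzf)) lexi_cons lexx.
- by apply/mapP; exists (mlead f); rewrite ?mlead_supp.
- by rewrite mnK polyC_eq0 mleadc_eq0.
move=> v; rewrite size_tuple => sv Dv.
have [S sS cS] := Dv 1%N; rewrite big_nat1 in cS.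
have [t ht] : exists t, (k <= count_mem t v)%N.
  case: S sS cS => [|t [|//]] _ cS.
    exists 0; apply: leq_trans (leq_trans le_k cS) _.
    by rewrite (@eq_count _ _ pred0) ?count_pred0.
  exists t; apply: leq_trans (leq_trans le_k cS) _.
  by rewrite (@eq_count _ _ (pred1 t)) // => x; rewrite /= inE.
rewrite -(@card_coord _ 0) // in ht.
rewrite -(van _ _ ht) /terms_eval big_map /peval /mmap; apply: eq_bigr => b _.
rewrite mnK monomE ?size_tuple // sv; congr (_ * _); apply: eq_bigr => i _.
by rewrite -mnm_nth.
Qed.

Lemma pevalX v i : peval v 'X_i = v i.
Proof. by rewrite /peval mmapX mmap1U. Qed.

Lemma pevalM v f g : peval v (f * g) = peval v f * peval v g.
Proof. exact: rmorphM. Qed.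

Lemma peval_sum v T (r : seq T) (F : T -> {mpoly K[m]}) :
  peval v (\sum_(i <- r) F i) = \sum_(i <- r) peval v (F i).
Proof. exact: rmorph_sum. Qed.

Lemma pevalB v f g : peval v (f - g) = peval v f - peval v g.
Proof. exact: rmorphB. Qed.

Lemma vanishingB k f g : vanishing k f -> vanishing k g -> vanishing k (f - g).
Proof. by move=> hf hg v t h; rewrite pevalB (hf _ _ h) (hg _ _ h) subrr. Qed.

Lemma vanishingM k f g : vanishing k g -> vanishing k (f * g).
Proof. by move=> hg v t h; rewrite pevalM (hg _ _ h) mulr0. Qed.

Lemma subset_ideal_vanishing k f : subset_ideal K m k f -> vanishing k f.
Proof.
move=> hf v t /card_geqP[s [us ss ks]].
have /hf[c hc ->] : #|[set i in s]| = k by rewrite cardsE (card_uniqP us).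
rewrite peval_sum big_seq big1 // => p /hc[i [j []]]; rewrite !inE => is_ js ->.
have := ks _ is_; have := ks _ js; rewrite !inE => /eqP vj /eqP vi.
by rewrite pevalM pevalB !pevalX vi vj subrr mulr0.
Qed.

(** The condition is invariant under scaling the point by s, and the value at the
scaled point is a polynomial in s whose coefficients are the values of the
components; it has infinitely many roots. *)
Lemma vanishing_pihomog k d f : vanishing k f -> vanishing k (pihomog mdeg d f).
Proof.
move=> hf v t ht.
pose q : {poly {poly K}} :=
  \sum_(e < msize f) (peval v (pihomog mdeg e f)) *: 'X^e.
have evs s e : peval (fun i => s * v i) (pihomog mdeg e f)
    = s ^+ e * peval v (pihomog mdeg e f).
  rewrite /peval !pihomogE !raddf_sum mulr_sumr /=; apply: eq_bigr => b /eqP be.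
  rewrite !mmapZ !mmapX mulrCA; congr (_ * _).
  rewrite /mmap1 -be mdegE -prodrXr -big_split /=.
  by apply: eq_bigr => i _; rewrite exprMn.
have root_q s : root q s.
  pose w i := s * v i.
  have hst : (k <= #|[set i | w i == (s * t)%R]|)%N.
    apply: leq_trans ht _; apply/subset_leq_card/subsetP => i.
    by rewrite !inE /w => /eqP->.
  apply/eqP; rewrite -[RHS](hf _ _ hst).
  rewrite [in RHS](@pihomog_partitionE _ _ mdeg (msize f) f) // peval_sum.
  by rewrite horner_sum; apply: eq_bigr => e _; rewrite hornerZ hornerXn evs mulrC.
have [us [uus sus _]] := fresh_seq (@poly_infinite K) [::] (size q).
have q0 : q = 0.
  apply/eqP/negPn/negP => nzq.
  have := max_poly_roots nzq _ uus; rewrite sus ltnn => h.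
  by suff : false by []; apply/h/allP => s _.
have [lt_d|le_d] := ltnP d (msize f); last first.
  rewrite pihomogE big1_seq ?[LHS]raddf0 // => b /andP[/eqP be bf].
  by have := msize_mdeg_lt bf; rewrite be ltnNge le_d.
have : q`_d = 0 by rewrite q0 coef0.
rewrite coef_sum (bigD1 (Ordinal lt_d)) //= coefZ coefXn eqxx mulr1 big1 ?addr0 //.
by move=> e ne; rewrite coefZ coefXn eq_sym (negPf (ne : val e != d)) mulr0.
Qed.

End Null.

(** * Products of Vandermonde determinants *)

Section Shuffles.
Local Open Scope ring_scope.

(** The two identities below match the cofactors in the interpolation formula of
[vander_exchange]: s and s' are signs, x a product of differences, r the factors
free of the distinguished variable. *)
Lemma sign_shuffle (A : comNzRingType) (s s' x r y : A) : s' ^+ 2 = 1 ->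
  s * s' * y * (s' * x * r) = s * r * (y * x).
Proof.
move=> s2; have -> : s * s' * y * (s' * x * r) = s' ^+ 2 * (s * r * (y * x)) by ring.
by rewrite s2 mul1r.
Qed.

Lemma mul_shuffle (A : comNzRingType) (s x r y : A) :
  s * x * r * y - s * r * y * x = 0.
Proof. ring. Qed.

Lemma horner_prod_XsubC_set (A : comNzRingType) (T : finType) (S : {set T})
    (F : T -> A) (x : A) :
  (\prod_(j <- enum S) ('X - (F j)%:P)).[x] = \prod_(j in S) (x - F j).
Proof.
by rewrite horner_prod big_enum; apply: eq_bigr => j _; rewrite hornerXsubC.
Qed.

End Shuffles.

Section Vander.
Local Open Scope ring_scope.
Variables (K : fieldType) (m : nat).
Implicit Types (b : 'I_m -> nat) (i j : 'I_m).
Notation R := {mpoly K[m]}.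

Definition inner_pair b : pred ('I_m * 'I_m) :=
  fun p => (p.1 < p.2)%N && (b p.1 == b p.2).

Definition vander b : R := \prod_(p | inner_pair b p) ('X_p.1 - 'X_p.2).

Lemma lt_mnm1 i j : (i < j)%N -> ((U_(j))%MM < (U_(i))%MM :> 'X_{1..m})%O.
Proof.
move=> lt_ij; apply/ltmcP; first by rewrite !mdeg1.
exists i => [k lt_ki|]; rewrite !mnm1E.
  by rewrite -!val_eqE /= !gtn_eqF // (ltn_trans lt_ki).
by rewrite eqxx -val_eqE gtn_eqF.
Qed.

Lemma mlead_diff i j : (i < j)%N -> mlead ('X_i - 'X_j : R) = U_(i)%MM.
Proof. by move=> lt; rewrite mleadDl mleadXm // mleadN mleadXm lt_mnm1. Qed.

Lemma mleadc_diff i j : (i < j)%N -> mleadc ('X_i - 'X_j : R) = 1.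
Proof.
move=> lt; rewrite mlead_diff // mcoeffB !mcoeffX eqxx.
by rewrite (lt_eqF (lt_mnm1 lt)) subr0.
Qed.

Lemma diff_neq0 i j : i != j -> 'X_i - 'X_j != 0 :> R.
Proof.
move=> ne; apply/negP => /eqP /(congr1 (mcoeff U_(i)%MM)).
rewrite mcoeffB !mcoeffXU eqxx eq_sym (negPf ne) subr0 mcoeff0 => /eqP.
by rewrite oner_eq0.
Qed.

Lemma vander_neq0 b : vander b != 0.
Proof.
apply/prodf_neq0 => -[i j] /andP[/= lt _]; apply: diff_neq0.
by rewrite -val_eqE ltn_eqF.
Qed.

(** The leading monomial of x_i - x_j, for i < j, is x_i. *)
Lemma mlead_vander b i :
  mlead (vander b) i = #|[set j : 'I_m | (i < j)%N && (b i == b j)]|.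
Proof.
rewrite mlead_prod; last first.
  by move=> [k l] _ /andP[/= lt _]; rewrite diff_neq0 // -val_eqE ltn_eqF.
rewrite mnm_sumE (eq_bigr (fun p : 'I_m * 'I_m => (p.1 == i : nat))); last first.
  by move=> p /andP[lt _]; rewrite mlead_diff // mnm1E.
rewrite -big_mkcondr /= (reindex_onto (fun j => (i, j)) snd) /=; last first.
  by case=> k l /= /andP[_ /eqP->].
rewrite -sum1_card; apply: eq_bigl => j.
by rewrite /inner_pair inE /= !eqxx !andbT.
Qed.

Lemma mleadc_vander b : mleadc (vander b) = 1.
Proof.
have nz p : inner_pair b p -> 'X_p.1 - 'X_p.2 != 0 :> R.
  by case/andP=> lt _; rewrite diff_neq0 // -val_eqE ltn_eqF.
rewrite mlead_prod; last by move=> p _; apply: nz.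
rewrite mleadc_prod big1 // => p /andP[lt _]; exact: mleadc_diff.
Qed.

Lemma vander_homog b : vander b \is #|inner_pair b|.-homog.
Proof.
rewrite -sum1_card /vander.
elim/big_ind2: _ => [|p d q e|p _]; [exact: dhomog1|exact: dhomogM|].
by apply: rpredB; rewrite dhomogX /= mdeg1.
Qed.

Lemma vander_subset_ideal N b : (forall i, b i < N)%N ->
  subset_ideal K m N.+1 (vander b).
Proof.
move=> lt_b F cF.
have [i [j [iF jF lt_ij eb]]] : exists i j, [/\ i \in F, j \in F, (i < j)%N & b i = b j].
  pose c i : 'I_N := Ordinal (lt_b i).
  have : ~~ dinjectiveb c F.
    apply/negP => /dinjectiveP/card_in_image e.
    by have := max_card (mem (image c F)); rewrite e cF card_ord ltnn.
  case/dinjectivePn => i iF [j /andP[/= ne jF] /(congr1 val)/= eb].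
  case: (ltngtP i j) => [lt|lt|/val_inj e]; last by rewrite e eqxx in ne.
    by exists i, j.
  by exists j, i.
exists [:: (\prod_(p | inner_pair b p && (p != (i, j))) ('X_p.1 - 'X_p.2), 'X_i - 'X_j)].
  by move=> x; rewrite inE => /eqP->; exists i, j.
rewrite big_seq1 /= /vander (bigD1 (i, j)) /=; first by rewrite mulrC.
by rewrite /inner_pair /= lt_ij eb eqxx.
Qed.

(* splitting off one variable *)
(** The factors of [vander b] that do not involve x_i; they do not depend on the
label of i. *)
Definition rest b i : R :=
  \prod_(p | [&& inner_pair b p, p.1 != i & p.2 != i]) ('X_p.1 - 'X_p.2).

(** The number of factors of [vander b] in which x_i occurs with a minus sign. *)
Definition below b i : nat := \sum_(j < m | (j < i)%N && (b j == b i)) 1.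

Lemma vander_split b i : vander b =
  (-1) ^+ below b i * \prod_(j | (j != i) && (b j == b i)) ('X_i - 'X_j) * rest b i.
Proof.
rewrite /vander (bigID (fun p => p.1 == i)) /=.
have -> : \prod_(p | inner_pair b p && (p.1 == i)) ('X_p.1 - 'X_p.2 : R) =
    \prod_(j : 'I_m | (i < j)%N && (b j == b i)) ('X_i - 'X_j).
  rewrite (reindex_onto (fun j => (i, j)) snd) /=; last first.
    by case=> k l /= /andP[_ /eqP->].
  by apply: eq_bigl => j; rewrite /inner_pair /= !eqxx !andbT eq_sym.
rewrite [X in _ * X](bigID (fun p => p.2 == i)) /=.
have -> : \prod_(p | inner_pair b p && (p.1 != i) && (p.2 == i)) ('X_p.1 - 'X_p.2 : R) =
    \prod_(j : 'I_m | (j < i)%N && (b j == b i)) (- 1 * ('X_i - 'X_j)).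
  rewrite (reindex_onto (fun j => (j, i)) fst) /=; last first.
    by case=> k l /= /andP[_ /eqP->].
  apply: eq_big => [j|j _]; last by rewrite mulN1r opprB.
  rewrite /inner_pair /= !eqxx !andbT.
  by rewrite -val_eqE; case: ltngtP; rewrite ?andbF ?andbT.
rewrite big_split /= /below -prodrXr.
rewrite [X in _ = _ * X * _](bigID (fun j : 'I_m => i < j)%N) /=.
have -> : \prod_(j : 'I_m | (j != i) && (b j == b i) && (i < j)%N) ('X_i - 'X_j : R) =
    \prod_(j : 'I_m | (i < j)%N && (b j == b i)) ('X_i - 'X_j).
  by apply: eq_bigl => j; rewrite -val_eqE; case: ltngtP; rewrite ?andbF ?andbT.
have -> : \prod_(j : 'I_m | (j != i) && (b j == b i) && ~~ (i < j)%N) ('X_i - 'X_j : R) =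
    \prod_(j : 'I_m | (j < i)%N && (b j == b i)) ('X_i - 'X_j).
  by apply: eq_bigl => j; rewrite -val_eqE; case: ltngtP; rewrite ?andbF ?andbT.
have <- : \prod_(p | inner_pair b p && (p.1 != i) && (p.2 != i)) ('X_p.1 - 'X_p.2)
    = rest b i.
  by apply: eq_bigl => p; rewrite andbA.
by rewrite mulrA; congr (_ * _); rewrite mulrCA.
Qed.

Definition relabel b i (q : nat) : 'I_m -> nat := fun j => if j == i then q else b j.

Lemma rest_relabel b i q : rest (relabel b i q) i = rest b i.
Proof.
apply: eq_bigl => -[k l]; rewrite /inner_pair /relabel /=.
by case: (k == i); case: (l == i); rewrite ?andbF.
Qed.

Lemma mpolyX_inj : injective (fun i => 'X_i : R).
Proof.
move=> i j e; apply/eqP/negPn/negP => /diff_neq0.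
by rewrite e subrr eqxx.
Qed.

(** Let A and B be the blocks of p and q, and let P be the monic polynomial of
degree #|A| - 1 that is a power of X times the product of the X - x_j for j in B.
Interpolating P at the variables of A, with the denominators cleared by
[vander b], gives
  vander b * P = sum over i in A of C i * product of the X - x_j, j in A \ i,
where C i is P(x_i) times the part of [vander b] left after removing the factors
x_i - x_j. Since P(x_i) contains the factors of x_i with the block B, C i is up
to sign a power of x_i times the product in which i has moved to B. Comparing
the coefficients of degree #|A| - 1 gives the claim. *)
Lemma vander_exchange b p q : p != q ->
  (#|[set j | b j == q]| + 2 <= #|[set j | b j == p]|)%N ->
  exists c : 'I_m -> R,
    vander b = \sum_(i | b i == p) c i * vander (relabel b i q).
Proof.
move=> ne_pq; set B := [set j | b j == q]; set A := [set j | b j == p] => le_BA.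
pose e := (#|A| - #|B| - 1)%N.
pose P : {poly R} := 'X^e * \prod_(j <- enum B) ('X - ('X_j)%:P).
have PM : P \is monic by rewrite monicMl ?monicXn // monic_prod_XsubC.
have sP : size P = #|A|.
  rewrite size_monicM ?monicXn ?monic_neq0 ?monic_prod_XsubC //.
  rewrite size_polyXn size_prod_XsubC -cardE /e; lia.
pose C i := (-1) ^+ below b i * rest b i * P.['X_i].
exists (fun i => (-1) ^+ (below b i + below (relabel b i q) i) * 'X_i ^+ e).
have CE i : b i = p -> (-1) ^+ (below b i + below (relabel b i q) i) * 'X_i ^+ e
    * vander (relabel b i q) = C i.
  move=> bi; rewrite (vander_split (relabel b i q) i) rest_relabel /C.
  rewrite hornerM hornerXn horner_prod_XsubC_set.
  have -> : \prod_(j | (j != i) && (relabel b i q j == relabel b i q i)) ('X_i - 'X_j : R)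
      = \prod_(j in B) ('X_i - 'X_j).
    apply: eq_bigl => j.
    rewrite /relabel eqxx inE; case: eqP => [->|] //=.
    by rewrite bi (negPf ne_pq).
  rewrite exprD; have := sqrr_sign R (below (relabel b i q) i).
  set s' := (-1) ^+ below (relabel b i q) i => s2.
  exact: sign_shuffle.
have CD i : C i = (-1) ^+ below b i * rest b i * P.['X_i] by [].
clearbody C.
transitivity (\sum_(i | b i == p) C i); last by apply/esym/eq_bigr => i /eqP /CE.
pose Q : {poly R} := vander b *: P -
  \sum_(i in A) C i *: \prod_(j <- enum (A :\ i)) ('X - ('X_j)%:P).
have szA i : i \in A -> size (enum (A :\ i)) = #|A|.-1.
  by move=> iA; rewrite -cardE (cardsD1 i A) iA.
have A0 : (0 < #|A|)%N by lia.
have szQ : (size Q <= #|A|)%N.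
  rewrite (leq_trans (size_polyD _ _)) // geq_max size_polyN.
  rewrite (leq_trans (size_scale_leq _ _)) ?sP //=.
  rewrite (leq_trans (size_sum _ _ _)) //; apply/bigmax_leqP => i iA.
  by rewrite (leq_trans (size_scale_leq _ _)) // size_prod_XsubC szA // prednK.
have rQ i : i \in A -> root Q 'X_i.
  move=> iA; have bi : b i = p by move: iA; rewrite inE => /eqP.
  rewrite /root hornerD hornerN hornerZ horner_sum (bigD1 i) //=.
  rewrite [X in _ - (_ + X)]big1 ?addr0 => [|j /andP[jA ne]]; last first.
    rewrite hornerZ horner_prod_XsubC_set (bigD1 i) /=; last by rewrite !inE eq_sym ne bi eqxx.
    by rewrite subrr mul0r mulr0.
  rewrite hornerZ horner_prod_XsubC_set (vander_split b i) CD.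
  have -> : \prod_(j in A :\ i) ('X_i - 'X_j) =
      \prod_(j | (j != i) && (b j == b i)) ('X_i - 'X_j : R).
    by apply: eq_bigl => j; rewrite !inE bi.
  by apply/eqP/mul_shuffle.
have Q0 : Q = 0.
  apply/eqP/negPn/negP => nzQ.
  have := @max_poly_roots _ Q [seq ('X_i : R) | i <- enum A] nzQ.
  rewrite map_inj_uniq ?enum_uniq; last exact: mpolyX_inj.
  rewrite size_map -cardE => h; have /h/(_ isT) : all (root Q) [seq ('X_i : R) | i <- enum A].
    by apply/allP => x /mapP[i]; rewrite mem_enum => /rQ ri ->.
  by rewrite ltnNge szQ.
have : Q`_(#|A|.-1) = 0 by rewrite Q0 coef0.
rewrite coefB coefZ -sP -/(lead_coef P) (monicP PM) mulr1 coef_sum => /eqP.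
rewrite subr_eq0 => /eqP->; apply: eq_big => [i|i iA]; first by rewrite inE.
rewrite coefZ sP -(szA i) //.
have := monic_prod_XsubC (enum (A :\ i)) xpredT (fun j => 'X_j : R).
have := size_prod_XsubC (enum (A :\ i)) (fun j => 'X_j : R).
by rewrite monicE lead_coefE => -> /eqP ->; rewrite mulr1.
Qed.

End Vander.

(** * Balancing the blocks *)

Section Blocks.
Variable m : nat.
Implicit Types (b : 'I_m -> nat).

Definition block_size b p := #|[set j | b j == p]|.

Lemma block_sizeE b p : block_size b p = \sum_j (b j == p).
Proof.
rewrite /block_size cardsE -sum1_card big_mkcond; apply: eq_bigr => j _.
by rewrite unfold_in [RHS]/nat_of_bool.
Qed.

Lemma sum_block_size b N (F : nat -> nat) : (forall i, b i < N) ->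
  \sum_(p < N) block_size b p * F p = \sum_i F (b i).
Proof.
move=> lt_b; rewrite [RHS](partition_big (fun i => Ordinal (lt_b i)) xpredT) //=.
apply: eq_bigr => p _; rewrite /block_size cardsE -sum1_card big_distrl /=.
rewrite (eq_bigl (fun i => Ordinal (lt_b i) == p)) => [|i]; last by rewrite -val_eqE.
by apply: eq_bigr => i /eqP <-; rewrite mul1n.
Qed.

(** Both sides count the ordered pairs of equally labelled variables. *)
Lemma card_inner_pair b N : (forall i, b i < N) ->
  2 * #|inner_pair b| + m = \sum_(p < N) block_size b p ^ 2.
Proof.
move=> lt_b; rewrite (eq_bigr (fun p : 'I_N => block_size b p * block_size b p)); last first.
  by move=> p _; rewrite -mulnn.
rewrite (sum_block_size (block_size b)) //.
have -> : #|inner_pair b| = \sum_(i < m) \sum_(j < m) ((i < j) && (b i == b j)).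
  rewrite pair_big /= -sum1_card big_mkcond; apply: eq_bigr => p _.
  by rewrite /inner_pair unfold_in; case: ifP.
rewrite mul2n -addnn [X in _ + X + _]exchange_big /=.
have diag : m = \sum_(i < m) \sum_(j < m) (i == j).
  rewrite (eq_bigr (fun=> 1)) ?sum1_card ?card_ord // => i _.
  by rewrite (bigD1 i) //= eqxx big1 // => j; rewrite eq_sym => /negPf->.
rewrite [X in _ + X = _]diag -!big_split; apply: eq_bigr => i _ /=.
rewrite block_sizeE -!big_split /=.
apply: eq_bigr => j _; rewrite -val_eqE [b j == b i]eq_sym /=.
by case: (ltngtP i j) => [_|_|/val_inj->] /=; rewrite ?eqxx // ?addn0 ?add0n; case: eqP.
Qed.

Lemma block_size_relabel b i q p : b i != q ->
  block_size (relabel b i q) p + (p == b i) = block_size b p + (p == q).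
Proof.
move=> ne; rewrite !block_sizeE (bigD1 i) //= [X in _ = X + _](bigD1 i) //=.
have -> : \sum_(j | j != i) (relabel b i q j == p) = \sum_(j | j != i) (b j == p).
  by apply: eq_bigr => j /negPf ne_ji; rewrite /relabel ne_ji.
by rewrite {1}/relabel eqxx [q == p]eq_sym [b i == p]eq_sym addnAC [RHS]addnC addnA addnAC.
Qed.

Lemma card_inner_pair_relabel b N i q : (forall j, b j < N) -> q < N ->
  block_size b q + 2 <= block_size b (b i) ->
  #|inner_pair (relabel b i q)| < #|inner_pair b|.
Proof.
move=> lt_b lt_q le_q; have ne : b i != q by apply: contraTneq le_q => ->; lia.
have lt_mv j : relabel b i q j < N by rewrite /relabel; case: ifP.
rewrite -(ltn_pmul2l (isT : 0 < 2)) -(ltn_add2r m).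
rewrite (card_inner_pair lt_mv) (card_inner_pair lt_b).
have mv := block_size_relabel _ ne.
pose p0 := Ordinal (lt_b i); pose q0 := Ordinal lt_q.
have ne' : q0 != p0 by rewrite -val_eqE eq_sym.
rewrite (bigD1 p0) //= (bigD1 q0) //= [X in _ < X](bigD1 p0) //= [X in _ < _ + X](bigD1 q0) //=.
have -> : \sum_(j < N | (j != p0) && (j != q0)) block_size (relabel b i q) j ^ 2 =
          \sum_(j < N | (j != p0) && (j != q0)) block_size b j ^ 2.
  apply: eq_bigr => j /andP[jp jq]; have := mv j.
  have -> : (j == b i :> nat) = false by apply/negbTE.
  have -> : (j == q :> nat) = false by apply/negbTE.
  by rewrite !addn0 => ->.
have := mv (b i); have := mv q; rewrite !eqxx [q == _]eq_sym (negPf ne).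
rewrite !addn0 !addnA ltn_add2r => -> h.
have -> : block_size (relabel b i q) (b i) = block_size b (b i) - 1 by lia.
by move: le_q; move: (block_size b q) (block_size b (b i)) => x y; nia.
Qed.

(** With N <= m <= 2 N, balanced blocks have sizes 1 and 2: an empty block would
force all sizes to be at most 1, a block of size 3 all sizes to be at least 2.
On these sizes s ^ 2 = 3 s - 2, so [card_inner_pair] gives the degree. *)
Lemma card_inner_pair_balanced b N d : m = N + d -> (forall i, b i < N) ->
  (forall p q : 'I_N, block_size b p <= block_size b q + 1) ->
  d <= N -> #|inner_pair b| = d.
Proof.
move=> mE lt_b bal le_d.
have tot : \sum_(p < N) block_size b p = m.
  have := sum_block_size (fun=> 1) lt_b; rewrite sum1_card card_ord => <-.
  by apply: eq_bigr => p _; rewrite muln1.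
have pos (p : 'I_N) : 0 < block_size b p.
  rewrite lt0n; apply/negP => /eqP p0.
  have : \sum_(p < N) block_size b p < N; last by lia.
  rewrite (bigD1 p) //= p0 add0n.
  have cN : N = (\sum_(i < N | i != p) 1).+1.
    by have := sum1_card 'I_N; rewrite card_ord (bigD1 p) //= add1n.
  by rewrite [X in _ < X]cN ltnS; apply: leq_sum => q _; have := bal q p; rewrite p0.
have le2 (p : 'I_N) : block_size b p <= 2.
  rewrite leqNgt; apply/negP => p3.
  have : 2 * N < \sum_(p < N) block_size b p; last by lia.
  rewrite (bigD1 p) //=.
  have cN : 2 * N = 2 + \sum_(i < N | i != p) 2.
    have := sum_nat_const 'I_N 2; rewrite card_ord (bigD1 p) //= => ->; exact: mulnC.
  by rewrite cN -addSn leq_add //; apply: leq_sum => q _; have := bal p q; lia.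
have := card_inner_pair lt_b.
have : \sum_(p < N) block_size b p ^ 2 + 2 * N = 3 * m; last by lia.
have -> : 2 * N = \sum_(p < N) 2 by rewrite sum_nat_const card_ord mulnC.
rewrite -tot big_distrr -big_split; apply: eq_bigr => p _ /=.
by have := pos p; have := le2 p; case: (block_size b p) => [|[|[]]].
Qed.

End Blocks.

(** * Minimal generators *)

Section Main.
Local Open Scope ring_scope.
Variables (K : fieldType) (m : nat).
Notation R := {mpoly K[m]}.

Definition column (a : seq nat) : 'I_m -> nat := fun i => nth 0%N (columns a) i.

Definition greedy_vander a : R := vander K (column a).

Lemma mlead_greedy a (i : 'I_m) : size a = m ->
  mlead (greedy_vander a) i =
  count_mem (rows (drop i.+1 a) (nth 0%N a i)) (columns (drop i.+1 a)).
Proof.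
move=> sa; rewrite mlead_vander -nth_columns ?sa // -drop_columns.
set c := columns a; have sc : size c = m by rewrite size_columns.
rewrite -sum1_card -sum1_count (big_nth 0%N) size_drop sc.
rewrite (eq_bigl (fun j : 'I_m => (column a j == nth 0%N c i) && (i < j)%N)); last first.
  by move=> j; rewrite inE andbC eq_sym.
rewrite -(big_geq_mkord i.+1 m (fun j => nth 0%N c j == nth 0%N c i) (fun=> 1%N)).
rewrite -{1}[i.+1]add0n big_addn; apply: eq_bigl => j.
by rewrite nth_drop addnC.
Qed.

Lemma mlead_greedy_le a (i : 'I_m) : size a = m ->
  (mlead (greedy_vander a) i <= nth 0%N a i)%N.
Proof. by move=> sa; rewrite mlead_greedy // count_columns_le. Qed.

(** In a ballot word an entry 1 selects a column with one box, since row 1 is then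
shorter than row 0. *)
Lemma mlead_greedy_ballot a (i : 'I_m) : size a = m -> ballot a ->
  mlead (greedy_vander a) i = nth 0%N a i.
Proof.
move=> sa ba; apply/eqP; rewrite eqn_leq mlead_greedy_le // mlead_greedy //.
have := ballot_drop i ba; rewrite (drop_nth 0%N) ?sa // ballot_cons.
case/andP=> _ /orP[/eqP->//|/andP[/eqP-> lt]].
by rewrite count_columns.
Qed.

Lemma column_lt a (i : 'I_m) : size a = m -> (column a i < rows a 0)%N.
Proof.
by move=> sa; apply/columns_lt/mem_nth; rewrite size_columns sa.
Qed.

(** A record for predicates in Prop, as are those of [ideal_gen]. *)
Record is_ideal (I : R -> Prop) : Prop := IsIdeal {
  ideal0 : I 0;
  idealD : forall p q, I p -> I q -> I (p + q);
  idealM : forall c p, I p -> I (c * p) }.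

Lemma ideal_sum I (T : eqType) (r : seq T) (P : pred T) (F : T -> R) : is_ideal I ->
  (forall x, x \in r -> P x -> I (F x)) -> I (\sum_(x <- r | P x) F x).
Proof.
move=> idI h; rewrite big_seq_cond; elim/big_ind: _ => //.
- exact: ideal0.
- exact: idealD.
- by move=> x /andP[]; apply: h.
Qed.

Lemma ideal_gen_is_ideal (S : R -> Prop) : is_ideal (ideal_gen S).
Proof.
split.
- by exists [::]; rewrite ?big_nil.
- move=> p q [s hs ->] [t ht ->]; exists (s ++ t); last by rewrite big_cat.
  by move=> c; rewrite mem_cat => /orP[/hs|/ht].
- move=> c p [s hs ->]; exists [seq (c * x.1, x.2) | x <- s].
    by move=> y /mapP[x /hs hx ->].
  by rewrite big_map mulr_sumr; apply: eq_bigr => x _; rewrite mulrA.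
Qed.

Lemma ideal_gen_mem (S : R -> Prop) p : S p -> ideal_gen S p.
Proof.
move=> Sp; exists [:: (1, p)]; last by rewrite big_seq1 mul1r.
by move=> c; rewrite inE => /eqP->.
Qed.

Lemma subset_ideal_is_ideal k : is_ideal (subset_ideal K m k).
Proof.
split=> [F cF|p q hp hq F cF|c p hp F cF].
- exact: (ideal0 (ideal_gen_is_ideal _)).
- by apply: (idealD (ideal_gen_is_ideal _)); [apply: hp|apply: hq].
- by apply: (idealM (ideal_gen_is_ideal _)); apply: hp.
Qed.

(** Division by the products that the leading exponents label. The degree is
fixed, so that I need only contain the products met on the way; this is used
once in degree d, where these are the products of ballot words, and once in
every degree. *)
Lemma homog_reduction N d (I : R -> Prop) : is_ideal I ->
  (forall f : R, f \is d.-homog -> f != 0 -> vanishing N.+1 f ->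
     I (greedy_vander (mlead f))) ->
  forall f : R, f \is d.-homog -> vanishing N.+1 f -> I f.
Proof.
move=> idI hI; elim/mleadrect => f IH hf vf.
have [->|nzf] := eqVneq f 0; first exact: ideal0.
set a := mlead f; pose g := greedy_vander a; have sa : size a = m by rewrite size_tuple.
have r0 := rows_mlead hf nzf vf.
have vg : vanishing N.+1 g.
  apply/subset_ideal_vanishing/vander_subset_ideal => i.
  by apply: leq_trans (column_lt i sa) _; rewrite -ltnS.
have le_ga : (mlead g <= a)%MM.
  by apply/mnm_lepP => i; rewrite (mnm_nth 0%N a) mlead_greedy_le.
pose h : R := f@_a *: 'X_[a - mlead g] * g.
have hm : h@_a = f@_a.
  have := mcoeffMX g (a - mlead g) (mlead g); rewrite submK // mleadc_vander => e.
  by rewrite /h -scalerAl mcoeffZ mulrC [_ * g]mulrC e mul1r.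
have nzg : g != 0 by apply: vander_neq0.
have lh : mlead h = a.
  rewrite mleadM ?mleadZ ?mleadXm ?submK ?mleadc_eq0 //.
  by rewrite scaler_eq0 mleadc_eq0 (negPf nzf) /= -mleadc_eq0 mleadXm mcoeffX eqxx oner_eq0.
have hh : h \is d.-homog.
  have hd : mdeg a = d by apply: (dhomog_mf hf); apply: mlead_supp.
  have := vander_homog K (column a) => hg.
  have dg : mdeg (mlead g) = #|inner_pair (column a)|.
    by apply: (dhomog_mf hg); apply: mlead_supp.
  rewrite -hd -(submK le_ga) mdegD dg; apply: dhomogM hg.
  by apply: rpredZ; rewrite dhomogX.
have Ih : I h by apply: (idealM idI); apply: hI.
have vh : vanishing N.+1 h by apply: vanishingM.
have -> : f = (f - h) + h by rewrite subrK.
apply: (idealD idI) => //.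
have [->|nz] := eqVneq (f - h) 0; first exact: ideal0.
apply: IH; [|exact: rpredB|exact: vanishingB].
rewrite lt_neqAle; apply/andP; split.
  apply/eqP => e; have := mleadc_eq0 (f - h).
  by rewrite e mcoeffB hm subrr eqxx (negPf nz).
by apply: le_trans (mleadB_le _ _) _; rewrite lh joinxx.
Qed.

Lemma vanishing_reduction N (I : R -> Prop) : is_ideal I ->
  (forall b, (forall i, b i < N)%N -> I (vander K b)) ->
  forall f : R, vanishing N.+1 f -> I f.
Proof.
move=> idI hI f vf; rewrite (@pihomog_partitionE _ _ mdeg (msize f) f) //.
apply: ideal_sum => // d _ _; apply: (homog_reduction (N := N) (d := d)) => //.
- move=> g hg nzg vg; apply: hI => i.
  by apply: leq_trans (column_lt i (size_tuple _)) _; rewrite -ltnS; apply: (rows_mlead hg nzg vg).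
- exact: pihomogP.
- exact: vanishing_pihomog.
Qed.

(** Each exchange lowers the number of inner pairs, that is, the degree. *)
Lemma vander_balancing N d (I : R -> Prop) : is_ideal I -> m = (N + d)%N -> (d <= N)%N ->
  (forall b, (forall i, b i < N)%N -> #|inner_pair b| = d -> I (vander K b)) ->
  forall b, (forall i, b i < N)%N -> I (vander K b).
Proof.
move=> idI mE le_d hI b; have [n] := ubnP #|inner_pair b|.
elim: n b => // n IH b lt_n lt_b.
have [|bal] := boolP [exists p : 'I_N, [exists q : 'I_N,
    block_size b q + 2 <= block_size b p]%N].
  case/existsP=> p /existsP[q le_q].
  have ne : val p != val q by apply/eqP => /= e; move: le_q; rewrite e; lia.
  have [c ->] := @vander_exchange K m b p q ne le_q.
  apply: ideal_sum => // i _ /eqP bi; apply: (idealM idI); apply: IH.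
    rewrite -ltnS; apply: leq_trans lt_n; rewrite ltnS; apply: (card_inner_pair_relabel lt_b) => //.
    by rewrite bi.
  by move=> j; rewrite /relabel; case: ifP.
apply: hI => //; apply: (card_inner_pair_balanced mE) => // p q.
move: bal; rewrite negb_exists => /forallP/(_ p); rewrite negb_exists => /forallP/(_ q).
lia.
Qed.

Lemma mdeg_sumn (a : 'X_{1..m}) : mdeg a = sumn a.
Proof. by rewrite sumnE. Qed.

Lemma rows_ballot N d (a : seq nat) : size a = (N + d)%N -> sumn a = d ->
  (rows a 0 <= N)%N -> ballot a.
Proof.
by move=> sa da r0; rewrite /ballot eqn_leq size_le_rows andbT sa da leq_add2r.
Qed.

(** By [size_le_rows], a leading exponent of degree less than d would have a row 0
longer than N. *)
Lemma low_degree N d (f : R) (b : 'X_{1..m}) : m = (N + d)%N ->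
  vanishing N.+1 f -> (mdeg b < d)%N -> f@_b = 0.
Proof.
move=> mE vf lt_b; pose g := pihomog mdeg (mdeg b) f.
have hg : g \is (mdeg b).-homog := pihomogP _ _ _.
have g0 : g = 0.
  apply/eqP/negPn/negP => nzg.
  have r0 := rows_mlead hg nzg (@vanishing_pihomog _ _ _ (mdeg b) _ vf).
  have := size_le_rows (mlead g); rewrite size_tuple -mdeg_sumn.
  by rewrite (dhomog_mf hg (mlead_supp nzg)); move: r0 lt_b mE; lia.
rewrite (@pihomog_partitionE _ _ mdeg (maxn (msize f) (mdeg b).+1) f) ?leq_maxl //.
rewrite raddf_sum big1 //= => e _.
have [e_b|ne] := eqVneq (val e) (mdeg b); first by rewrite e_b -/g g0 mcoeff0.
by rewrite (dhomog_nemf_coeff (pihomogP _ _ _)) // eq_sym.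
Qed.

Lemma mcoeffM_low (p q : R) (b : 'X_{1..m}) :
  (forall b' : 'X_{1..m}, (mdeg b' < mdeg b)%N -> q@_b' = 0) ->
  (p * q)@_b = p@_0 * q@_b.
Proof.
move=> low; rewrite mcoeffM (bigD1 (bm0, BMultinom (ltnSn (mdeg b)))) /=; last first.
  by rewrite add0m.
rewrite big1 ?addr0 // => -[k1 k2] /= /andP[/eqP be ne].
rewrite low ?mulr0 // [X in (_ < mdeg X)%N]be mdegD.
rewrite -[X in (X < _)%N]add0n ltn_add2r lt0n mdeg_eq0.
apply: contra ne => /eqP k10; rewrite xpair_eqE !bmeqP /= k10 eqxx /=.
by rewrite [X in _ == X]be k10 add0m.
Qed.

(** In degree d only the constant terms of the cofactors contribute
([mcoeffM_low]), so the products of ballot words have their coefficients in the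
row space of those of s. Restricted to the monomials that are ballot words, their
coefficient matrix A is square and free: in a relation between its rows, look at
the largest leading monomial that occurs. *)
Lemma size_generators N d (s : seq R) : m = (N + d)%N ->
  generates s (subset_ideal K m N.+1) -> (size (words m d) <= size s)%N.
Proof.
move=> mE gen; set W := words m d; pose n := size W.
pose w (i : 'I_n) := nth [::] W i.
have wP i : [/\ size (w i) = m, sumn (w i) = d & ballot (w i)].
  by have := mem_nth [::] (ltn_ord i); rewrite -/(w i) mem_words => /and3P[/eqP ? /eqP ? ?].
pose mn (i : 'I_n) := mlead (greedy_vander (w i)).
have mnE i (j : 'I_m) : mn i j = nth 0%N (w i) j.
  by have [sw _ bw] := wP i; rewrite /mn mlead_greedy_ballot.
have mn_inj : injective mn.
  move=> i j /mnmP e; apply: val_inj; apply/eqP.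
  rewrite -(nth_uniq [::] (ltn_ord i) (ltn_ord j) (uniq_words m d)).
  have [swi _ _] := wP i; have [swj _ _] := wP j.
  apply/eqP/(@eq_from_nth _ 0%N); rewrite -/(w i) -/(w j) swi ?swj // => k lt_k.
  by rewrite -(mnE i (Ordinal lt_k)) e mnE.
have mdeg_mn i : mdeg (mn i) = d.
  have [sw dw _] := wP i; rewrite -[RHS]dw mdegE sumnE (big_nth 0%N) sw big_mkord.
  by apply: eq_bigr => j _; rewrite mnE.
have s_low x b : x \in s -> (mdeg b < d)%N -> x@_b = 0.
  move=> xs; apply: (low_degree mE); apply: subset_ideal_vanishing.
  by apply/gen; apply: ideal_gen_mem.
pose A : 'M[K]_n := \matrix_(i, j) (greedy_vander (w i))@_(mn j).
pose B : 'M[K]_(size s, n) := \matrix_(l, j) (s`_l)@_(mn j).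
have AB : (A <= B)%MS.
  apply/row_subP => i.
  have /gen [t ht eg] : subset_ideal K m N.+1 (greedy_vander (w i)).
    apply: vander_subset_ideal => j; have [sw dw bw] := wP i.
    by apply: leq_trans (column_lt j sw) _; move/eqP: bw; rewrite sw dw; move: mE; lia.
  have -> : row i A = \sum_(c <- t) (c.1)@_0 *: \row_j (c.2)@_(mn j).
    apply/rowP => j; rewrite !mxE eg summxE raddf_sum /= !big_seq.
    apply: eq_bigr => c /ht cs; rewrite !mxE.
    by rewrite mcoeffM_low // => b; rewrite mdeg_mn; apply: s_low.
  rewrite big_seq; apply: summx_sub => c /ht cs; apply: scalemx_sub.
  have lt_c : (index c.2 s < size s)%N by rewrite index_mem.
  have -> : \row_j (c.2)@_(mn j) = row (Ordinal lt_c) B.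
    by apply/rowP => j; rewrite !mxE /= nth_index.
  exact: row_sub.
suff freeA : row_free A.
  by have := mxrankS AB; rewrite (eqP freeA) => /leq_trans; apply; apply: rank_leq_row.
rewrite -kermx_eq0; apply/rowV0P => u /sub_kermxP uA.
apply/eqP/negPn/negP => nzu.
have [i0 ui0] : exists i, u 0 i != 0.
  apply/existsP; rewrite -negb_forall; apply: contra nzu => /forallP h.
  by apply/eqP/rowP => i; rewrite mxE; apply/eqP/h.
case: (@Order.TotalTheory.arg_maxP _ _ _ i0 (fun i => u 0 i != 0) mn ui0) => i ui max_i.
have : (u *m A) 0 i = 0 by rewrite uA mxE.
rewrite mxE (bigD1 i) //= big1 => [|l ne_l]; rewrite !mxE.
  by rewrite addr0 mleadc_vander mulr1; apply/eqP.
have [->|ul] := eqVneq (u 0 l) 0; first by rewrite mul0r.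
rewrite mcoeff_gt_mlead ?mulr0 // -/(mn l) lt_neqAle (inj_eq mn_inj) ne_l.
exact: max_i.
Qed.

(** Reduction in degree d uses the products of ballot words only, so these span the
balanced products, which generate all [vander b] and thereby the ideal. *)
Lemma words_generate N d : m = (N + d)%N -> (d <= N)%N ->
  generates [seq greedy_vander a | a <- words m d] (subset_ideal K m N.+1).
Proof.
move=> mE le_d; set s := map _ _; pose I := ideal_gen (fun q : R => q \in s).
have idI : is_ideal I := ideal_gen_is_ideal _.
move=> f; split=> [/subset_ideal_vanishing vf|[t ht ->]]; last first.
  apply: ideal_sum (subset_ideal_is_ideal _) _ => c /ht /mapP[a].
  rewrite mem_words => /and3P[/eqP sa /eqP da ba] -> _.
  apply: (idealM (subset_ideal_is_ideal _)); apply: vander_subset_ideal => i.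
  by apply: leq_trans (column_lt i sa) _; move/eqP: ba; rewrite sa da; move: mE; lia.
apply: (vanishing_reduction idI) vf; apply: (vander_balancing idI mE le_d) => b lt_b cb.
apply: (homog_reduction (N := N) (d := d)) => //.
- move=> g hg nzg vg; apply: ideal_gen_mem; apply/map_f.
  have sg : sumn (mlead g) = d by rewrite -mdeg_sumn (dhomog_mf hg) ?mlead_supp.
  rewrite mem_words size_tuple sg !eqxx /=.
  by apply: (rows_ballot (N := N) (d := d)); rewrite -?mE ?size_tuple // -ltnS; apply: (rows_mlead hg nzg vg).
- by rewrite -cb; apply: vander_homog.
- exact/subset_ideal_vanishing/vander_subset_ideal.
Qed.

Theorem min_num_generators_words N d : m = (N + d)%N -> (d <= N)%N ->
  min_num_generators (subset_ideal K m N.+1) (size (words m d)).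
Proof.
move=> mE le_d; split; last by move=> s; apply: size_generators.
exists [seq greedy_vander a | a <- words m d]; split.
- by rewrite size_map.
- by move=> p /mapP[a _ ->]; exists #|inner_pair (column a)|; apply: vander_homog.
- exact: words_generate.
Qed.

End Main.

Theorem corollary3p12 (K : fieldType) :
  (forall n : nat, 1 <= n ->
     min_num_generators (subset_ideal K (2 * n) (n + 1)) (catalan n)) /\
  (forall n : nat, 2 <= n ->
     min_num_generators (subset_ideal K (2 * n - 1) (n + 1)) (catalan n)).
Proof.
split=> n le_n; rewrite addn1.
  rewrite -size_words_catalan.
  by apply: (@min_num_generators_words K (2 * n) n n); lia.
rewrite -size_words_catalan_pred; last by lia.
by apply: (@min_num_generators_words K (2 * n - 1) n n.-1); lia.
Qed.
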